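(* Let $I\subseteq(0,\infty)$ be an interval, let $f:I\to(0,\infty)$ be differentiable on the interior $I^{\circ}$ of $I$, let $a,b\in I^{\circ}$ with $a<b$, and suppose $f'\in L[a,b]$. Let $q\ge 1$ and $s\in(0,1]$, and suppose that $|f'|^{q}$ is $s$-geometrically convex on $[a,b]$. Then $$\left|\frac{f(a)+f(b)}{2}-\frac{1}{\ln b-\ln a}\int_a^b\frac{f(x)}{x}\,dx\right|\le \ln\left(\frac{b}{a}\right)\left(\frac12\right)^{2-\frac1q}H_1\bigl(s,q;g_1(\theta_1),g_1(\theta_2)\bigr)$$ and $$\left|f\left(\sqrt{ab}\right)-\frac{1}{\ln b-\ln a}\int_a^b\frac{f(x)}{x}\,dx\right|\le \ln\left(\frac{b}{a}\right)\left(\frac12\right)^{3-\frac1q}H_1\bigl(s,q;g_1(\theta_3),g_1(\theta_4)\bigr),$$ where $$g_1(u)=\begin{cases}\frac12, & u=1,\\[2pt] \dfrac{u\ln u-u+1}{(\ln u)^2}, & u\neq 1,\end{cases}$$ $$\theta_1=\left(\frac{b|f'(b)|^{s}}{a|f'(a)|^{s}}\right)^{q},\quad \theta_2=\left(\frac{a|f'(a)|^{s}}{b|f'(b)|^{s}}\right)^{q},\quad \theta_3=\sqrt{\theta_1},\quad \theta_4=\sqrt{\theta_2},$$ and, for $(i,j)=(1,2)$ and $(i,j)=(3,4)$, $$H_1\bigl(s,q;g_1(\theta_i),g_1(\theta_j)\bigr)=\begin{cases} a|f'(a)|^{s}g_1(\theta_i)^{1/q}+b|f'(b)|^{s}g_1(\theta_j)^{1/q},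 & |f'(a)|,|f'(b)|\le 1,\\ a|f'(a)||f'(b)|^{1-s}g_1(\theta_i)^{1/q}+b|f'(b)||f'(a)|^{1-s}g_1(\theta_j)^{1/q}, & |f'(a)|,|f'(b)|\ge 1,\\ a|f'(a)|^{s}|f'(b)|^{1-s}g_1(\theta_i)^{1/q}+b|f'(b)|g_1(\theta_j)^{1/q}, & |f'(a)|\le 1\le|f'(b)|,\\ a|f'(a)|g_1(\theta_i)^{1/q}+b|f'(b)|^{s}|f'(a)|^{1-s}g_1(\theta_j)^{1/q}, & |f'(b)|\le 1\le|f'(a)|. \end{cases}$$
   Context: For an interval $J\subset(0,\infty)$ and a fixed $s\in(0,1]$, a function $h:J\to(0,\infty)$ is called $s$-geometrically convex on $J$ if $h(x^{t}y^{1-t})\le h(x)^{t^{s}}h(y)^{(1-t)^{s}}$ for all $x,y\in J$ and $t\in[0,1]$. (In particular, such a function takes strictly positive values, so here $f'$ does not vanish on $[a,b]$.) $L[a,b]$ denotes the Lebesgue integrable functions on $[a,b]$. *)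

(* Defs.v *)
From mathcomp Require Import all_boot all_order all_algebra.
From mathcomp Require Import all_classical all_reals all_analysis.
Set Implicit Arguments. Unset Strict Implicit. Unset Printing Implicit Defensive.
Import Order.TTheory GRing.Theory Num.Theory.
Import numFieldNormedType.Exports.
Local Open Scope classical_set_scope.
Local Open Scope ring_scope.

(* Meant for J an interval of positive reals and 0 < s <= 1.  Since 0 < s,
   [0 `^ s = 0], so the exponents take their usual values at t = 0 and t = 1.
   The first conjunct says that h maps J to the positive reals. *)
Definition s_geometrically_convex (R : realType) (s : R) (J : set R)
    (h : R -> R) : Prop :=
  (forall x, J x -> 0 < h x) /\
  (forall x y t, J x -> J y -> 0 <= t <= 1 ->
     h (x `^ t * y `^ (1 - t)) <= h x `^ (t `^ s) * h y `^ ((1 - t) `^ s)).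

Definition g1 (R : realType) (u : R) : R :=
  if u == 1 then 2^-1 else (u * ln u - u + 1) / ln u ^+ 2.

(* da and db stand for |f'(a)| and |f'(b)|; u and v for the two values of g1.
   The four closed cases (the last one being db <= 1 <= da) overlap when da or
   db is 1, where the formulas agree, so the order of the tests is immaterial. *)
Definition H1 (R : realType) (a b da db s q u v : R) : R :=
  if (da <= 1) && (db <= 1) then
    a * da `^ s * u `^ q^-1 + b * db `^ s * v `^ q^-1
  else if (1 <= da) && (1 <= db) then
    a * da * db `^ (1 - s) * u `^ q^-1 + b * db * da `^ (1 - s) * v `^ q^-1
  else if (da <= 1) && (1 <= db) then
    a * da `^ s * db `^ (1 - s) * u `^ q^-1 + b * db * v `^ q^-1
  else
    a * da * u `^ q^-1 + b * db `^ s * da `^ (1 - s) * v `^ q^-1.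

(* Main.v *)
(* Put phi t = f (a^(1-t) b^t) and L = ln b - ln a, so that the mean is the
   integral of phi over [0, 1].  Distinguishing |f'| <= 1 from |f'| >= 1 at each
   endpoint, s-geometric convexity yields |phi' t| <= L C1 expR (m t), where C1
   and C2 = C1 expR m are the coefficients of H1.  For h = 1 (first inequality)
   and h = 1/2 (second one), the function x |-> x phi x - int_0^x phi has
   derivative x phi' x, so comparison with an antiderivative of x expR (m x)
   bounds its value at h by L C1 h^2 g1 (expR (m h)); the reflection
   t |-> 1 - t gives the C2 term.  Jensen's inequality for the weight 2 t dt
   introduces the exponent q.  Comparing derivatives instead of integrating f'
   avoids the fundamental theorem of calculus for a discontinuous f'. *)
Require Import Defs.
From mathcomp Require Import all_boot all_order all_algebra.
From mathcomp Require Import all_classical all_reals all_analysis.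
From mathcomp Require Import ring lra.
Set Implicit Arguments. Unset Strict Implicit. Unset Printing Implicit Defensive.
Import Order.TTheory GRing.Theory Num.Theory.
Import numFieldNormedType.Exports.
Local Open Scope classical_set_scope.
Local Open Scope ring_scope.

(** * Bernoulli's inequality and comparison of derivatives *)

(** Young's inequality for [y] and 1 with exponent [p] and its conjugate, multiplied by [p]. *)
Lemma bernoulli_powR (R : realType) (y p : R) : 0 <= y -> 1 <= p ->
  1 + p * (y - 1) <= y `^ p.
Proof.
move=> y0; rewrite le_eqVlt => /predU1P[<-|p1]; first by rewrite powRr1//; lra.
have p0 : 0 < p by lra.
have q0 : 0 < (1 - p^-1)^-1 by rewrite invr_gt0 subr_gt0 invf_lt1.
have := @conjugate_powR R y 1 p (1 - p^-1)^-1 y0 ler01 p0 q0.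
rewrite invrK addrC subrK => /(_ erefl).
rewrite powR1 mulr1 mul1r -(ler_pM2l p0) mulrDr mulrBr mulrCA divff ?gt_eqF//.
by lra.
Qed.

(** [B - D] has a nonnegative derivative, hence is nondecreasing. *)
Lemma le_sub_derive (R : realType) (D B dD dB : R -> R) (h : R) :
  0 <= h ->
  (forall x : R, 0 <= x <= h -> is_derive x (1 : R) D (dD x)) ->
  (forall x : R, 0 <= x <= h -> is_derive x (1 : R) B (dB x)) ->
  (forall x : R, 0 <= x <= h -> dD x <= dB x) ->
  D h - D 0 <= B h - B 0.
Proof.
move=> h0 dDP dBP dDB.
have dG x : 0 <= x <= h ->
    is_derive x (1 : R) (fun y => B y - D y) (dB x - dD x).
  move=> xh; have ? := dDP _ xh; have ? := dBP _ xh.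
  by apply: is_deriveB.
have sub x : x \in `]0, h[ -> 0 <= x <= h.
  by rewrite in_itv/= => /andP[/ltW-> /ltW->].
suff : B 0 - D 0 <= B h - D h by lra.
apply: (@ger0_derive1_le_cc R (fun y => B y - D y) 0 h).
- by move=> x /sub /dG [].
- move=> x /sub xh; rewrite derive1E (@derive_val _ _ _ _ _ _ _ (dG _ xh)).
  by rewrite subr_ge0 dDB.
- apply: derivable_within_continuous => x; rewrite in_itv/= => xh.
  by case: (dG _ xh).
- by rewrite in_itv/= lexx.
- by rewrite in_itv/= lexx h0.
- exact: h0.
Qed.

Lemma norm_sub_le_derive (R : realType) (D B dD dB : R -> R) (h : R) :
  0 <= h ->
  (forall x : R, 0 <= x <= h -> is_derive x (1 : R) D (dD x)) ->
  (forall x : R, 0 <= x <= h -> is_derive x (1 : R) B (dB x)) ->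
  (forall x : R, 0 <= x <= h -> `|dD x| <= dB x) ->
  `|D h - D 0| <= B h - B 0.
Proof.
move=> h0 dDP dBP dDB; rewrite ler_norml lerNl opprB; apply/andP; split.
  rewrite -(opprK (D 0)) [X in X <= _]addrC.
  apply: (@le_sub_derive _ (fun x => - D x) B (fun x => - dD x) dB) => // x xh.
    by have ? := dDP _ xh; apply: is_deriveN.
  by rewrite (le_trans _ (dDB _ xh))// -normrN ler_norm.
apply: (@le_sub_derive _ D B dD dB) => // x xh.
by rewrite (le_trans _ (dDB _ xh))// ler_norm.
Qed.

(** * First moments of the exponential and [g1] *)

(** An antiderivative of [x * expR (m * x)]. For nonzero [m] its value at 0 is [- 1 / m ^+ 2], so
    only its increments are meaningful. *)
Definition expR_moment (R : realType) (m x : R) : R :=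
  if m == 0 then x ^+ 2 / 2 else x * expR (m * x) / m - expR (m * x) / m ^+ 2.

Lemma is_derive_expR_scale (R : realType) (m x : R) :
  is_derive x (1 : R) (fun y => expR (m * y)) (m * expR (m * x)).
Proof.
have lin : is_derive x (1 : R) (fun y => m * y) m.
  by apply: is_derive_eq; rewrite /GRing.scale/= mulr1.
apply: (is_derive_eq (@is_derive1_comp _ expR (fun y => m * y) _ _ _ _ lin)).
by rewrite mulrC.
Qed.

Lemma is_derive_expR_moment (R : realType) (m x : R) :
  is_derive x (1 : R) (expR_moment m) (x * expR (m * x)).
Proof.
rewrite /expR_moment; case: eqVneq => [->|m0].
  rewrite mul0r expR0 mulr1.
  apply: is_derive_eq; rewrite /GRing.scale/=.
  by field.
have ? := is_derive_expR_scale m x.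
apply: is_derive_eq; rewrite /GRing.scale/=.
by field.
Qed.

Lemma g1_expR (R : realType) (u : R) : g1 (expR u) =
  if u == 0 then 2^-1 else (expR u * u - expR u + 1) / u ^+ 2.
Proof. by rewrite /g1 expRK -{1}expR0 (inj_eq (@expR_inj R)). Qed.

(** Both sides are the integral of [x * expR (m * x)] over [0, h]; rescaling to [0, 1] produces
    [h ^+ 2]. The case [m = 0] is the branch [u = 1] of [g1]. *)
Lemma expR_moment_g1 (R : realType) (m h : R) : 0 < h ->
  expR_moment m h - expR_moment m 0 = h ^+ 2 * g1 (expR (m * h)).
Proof.
move=> h0; rewrite g1_expR /expR_moment mulf_eq0 (gt_eqF h0) orbF.
case: eqVneq => [m0|m0]; first by field.
rewrite mulr0 expR0; field.
by rewrite m0 gt_eqF.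
Qed.

Lemma g1_ge0 (R : realType) (m : R) : 0 <= g1 (expR m).
Proof.
have := @norm_sub_le_derive R (cst 0) (expR_moment m) (cst 0)
  (fun x => x * expR (m * x)) 1 ler01.
rewrite (expR_moment_g1 _ ltr01) expr1n mul1r mulr1 => H.
apply: le_trans (normr_ge0 _) (H _ _ _) => x /andP[x0 _].
- exact: is_derive_expR_moment.
- by rewrite normr0 mulr_ge0 ?expR_ge0.
Qed.

(* Jensen's inequality for the probability weight [2 t dt] on [0, 1], since
   [g1 (expR m)] is the integral of [t * expR (m * t)] over [0, 1]. *)
Lemma g1_powR_le (R : realType) (m q : R) : 1 <= q ->
  g1 (expR m) <= 2^-1 `^ (1 - q^-1) * g1 (expR (q * m)) `^ q^-1.
Proof.
move=> q1; have q0 : 0 < q by lra.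
set G := g1 (expR m); set G' := g1 _.
have := g1_ge0 m; rewrite -/G le_eqVlt => /predU1P[<-|G0].
  by rewrite mulr_ge0 ?powR_ge0.
have y0 : 0 < 2 * G by lra.
pose c := (2 * G) `^ q.
have c0 : 0 < c by rewrite powR_gt0.
(* [2 * G] is the mean of [expR (m * x)] for the weight 2 x dx. The tangent to the [q]-th power at
   this mean is Bernoulli's inequality at [expR (m * x) / (2 * G)], scaled by [c]. *)
have tangent x : c * (1 - q + q / (2 * G) * expR (m * x)) <= expR (q * m * x).
  have -> : expR (q * m * x) = c * (expR (m * x) / (2 * G)) `^ q.
    rewrite -powRM ?divr_ge0 ?expR_ge0 ?(ltW y0)//.
    by rewrite mulrCA divff ?gt_eqF// mulr1 -expRM; congr expR; ring.
  rewrite ler_pM2l//; apply: le_trans (bernoulli_powR _ q1); last first.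
    by rewrite divr_ge0 ?expR_ge0// ltW.
  by rewrite le_eqVlt; apply/orP; left; apply/eqP; field; rewrite gt_eqF.
have cG' : c <= 2 * G'.
  (* An antiderivative of [x] times the tangent bound; the choice of the tangent point makes its
     increment over [0, 1] equal to [c / 2]. *)
  pose D x := c * (1 - q) * (x ^+ 2 / 2) + c * (q / (2 * G)) * expR_moment m x.
  pose dD x := c * (1 - q) * x + c * (q / (2 * G)) * (x * expR (m * x)).
  have := @le_sub_derive R D (expR_moment (q * m)) dD
    (fun x => x * expR (q * m * x)) 1 ler01.
  have -> : D 1 - D 0 = c * (1 - q) / 2 +
      c * (q / (2 * G)) * (expR_moment m 1 - expR_moment m 0).
    by rewrite /D; field; rewrite gt_eqF.
  rewrite !(expR_moment_g1 _ ltr01) !expr1n !mul1r !mulr1 -/G -/G'.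
  have -> : c * (1 - q) / 2 + c * (q / (2 * G)) * G = c / 2.
    by field; rewrite gt_eqF.
  move=> H; suff : c / 2 <= G' by lra.
  apply: H => x /andP[x0 _].
  - have ? := is_derive_expR_moment m x.
    apply: is_derive_eq; rewrite /GRing.scale/= /dD.
    by congr (_ * _ + _); field.
  - exact: is_derive_expR_moment.
  - rewrite /dD; have -> : c * (1 - q) * x + c * (q / (2 * G)) *
        (x * expR (m * x)) = x * (c * (1 - q + q / (2 * G) * expR (m * x))).
      by ring.
    exact: ler_wpM2l.
have GE : 2 * G = c `^ q^-1 by rewrite /c -powRrM divff ?gt_eqF// powRr1// ltW.
have G'0 : 0 <= G' by exact: g1_ge0.
(* Forgets the bodies of G, G' and c, which unification would unfold. *)
move: G G' c G'0 GE c0 cG' {tangent} G0 y0 => G G' c G'0 GE c0 cG' G0 y0.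
have : 2 * G <= 2 `^ q^-1 * G' `^ q^-1.
  rewrite -powRM// GE ge0_ler_powR// ?invr_ge0 ?nnegrE ?(ltW q0) ?(ltW c0)//.
  by rewrite mulr_ge0.
have -> : 2^-1 `^ (1 - q^-1) = 2^-1 * 2 `^ q^-1 :> R.
  rewrite -(@powR_inv1 R 2)// -powRrM mulrBr mulr1 mulN1r opprK powRD//.
  by rewrite pnatr_eq0 implybT.
by rewrite -mulrA; move: (2 `^ _ * _) => z; lra.
Qed.

(** * Estimates from the two ends of [0, 1] *)

Lemma left_estimate (R : realType) (phi dphi Theta : R -> R) (K m h : R) :
  (forall x : R, 0 <= x <= 1 -> is_derive x (1 : R) Theta (phi x)) ->
  (forall x : R, 0 <= x <= 1 -> is_derive x (1 : R) phi (dphi x)) ->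
  (forall x : R, 0 <= x <= 1 -> `|dphi x| <= K * expR (m * x)) ->
  0 < h <= 1 ->
  `|h * phi h - (Theta h - Theta 0)| <= K * (h ^+ 2 * g1 (expR (m * h))).
Proof.
move=> dTheta phi_derive dphi_le /andP[h0 h1].
rewrite -expR_moment_g1// mulrBr.
(* The left side becomes the increment over [0, h] of [x * phi x - Theta x]. *)
have -> : h * phi h - (Theta h - Theta 0) =
  (h * phi h - Theta h) - (0 * phi 0 - Theta 0) by ring.
apply: (@norm_sub_le_derive R (fun x => x * phi x - Theta x)
  (fun x => K * expR_moment m x) (fun x => x * dphi x)
  (fun x => K * (x * expR (m * x)))) => [|x|x _|x]; first exact: ltW.
- move=> /andP[x0 xh].
  have x01 : 0 <= x <= 1 by rewrite x0 (le_trans xh).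
  have ? := dTheta _ x01; have ? := phi_derive _ x01.
  by apply: is_derive_eq; rewrite /GRing.scale/=; ring.
- by have ? := is_derive_expR_moment m x; apply: is_derive_eq.
- move=> /andP[x0 xh].
  rewrite normrM ger0_norm// mulrCA ler_wpM2l// dphi_le//.
  by rewrite x0 (le_trans xh).
Qed.

Lemma right_estimate (R : realType) (phi dphi Theta : R -> R) (K m h : R) :
  (forall x : R, 0 <= x <= 1 -> is_derive x (1 : R) Theta (phi x)) ->
  (forall x : R, 0 <= x <= 1 -> is_derive x (1 : R) phi (dphi x)) ->
  (forall x : R, 0 <= x <= 1 -> `|dphi x| <= K * expR (m * x)) ->
  0 < h <= 1 ->
  `|h * phi (1 - h) - (Theta 1 - Theta (1 - h))|
    <= K * expR m * (h ^+ 2 * g1 (expR (- m * h))).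
Proof.
move=> dTheta dphiP dphi_le h01.
have sub (x : R) : 0 <= x <= 1 -> 0 <= 1 - x <= 1 by lra.
have lin (x : R) : is_derive x (1 : R) (fun y => 1 - y) (-1).
  by apply: is_derive_eq; rewrite add0r mul1r.
(* Under reflection [expR (m * (1 - x))] splits as [expR m * expR (- m * x)], which gives the new
   constant and rate. *)
have := @left_estimate R (fun x => phi (1 - x)) (fun x => - dphi (1 - x))
  (fun x => - Theta (1 - x)) (K * expR m) (- m) h.
rewrite subr0 opprK [- _ + _]addrC; apply=> // x /sub x01.
- have dT := dTheta _ x01.
  have ? := @is_derive1_comp _ Theta (fun y => 1 - y) x _ _ dT (lin x).
  by apply: is_derive_eq; rewrite mulrN1 opprK.
- have dT := dphiP _ x01.
  apply: (is_derive_eq (@is_derive1_comp _ phi (fun y => 1 - y) x _ _ dT (lin x))).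
  by rewrite mulrN1.
- rewrite normrN (le_trans (dphi_le _ x01))// -mulrA -expRD.
  by rewrite (_ : m + - m * x = m * (1 - x))//; ring.
Qed.

(** * Primitives on a neighbourhood of [a, b] *)

(** Integrating from a point slightly left of [a], inside a segment reaching beyond [b], makes the
    derivative two-sided at [a] and [b] too. *)
Lemma exists_primitive (R : realType) (g : R -> R) (a b e : R) :
  0 < e -> a < b -> (forall x, a - e < x < b + e -> {for x, continuous g}) ->
  exists2 F : R -> R, (forall x, a <= x <= b -> is_derive x (1 : R) F (g x)) &
    \int[@lebesgue_measure R]_(x in `[a, b]) g x = F b - F a.
Proof.
move=> e0 ab cg; pose a' := a - e / 2; pose b' := b + e / 2.
have cg' (l r : R) : a - e < l -> r < b + e -> {within `[l, r], continuous g}.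
  move=> al rb; apply: continuous_in_subspaceT => x.
  rewrite inE/= in_itv/= => /andP[lx xr]; apply: cg.
  by rewrite (lt_le_trans al) ?(le_lt_trans xr).
have ig : (@lebesgue_measure R).-integrable `[a', b'] (EFin \o g).
  apply: continuous_compact_integrable; first exact: segment_compact.
  by apply: cg'; rewrite /a' /b'; lra.
pose F x := \int[@lebesgue_measure R]_(t in `[a', x]) g t.
have dF x : a <= x <= b -> is_derive x (1 : R) F (g x).
  move=> /andP[ax xb].
  have xb' : x < b' by rewrite /b'; lra.
  have ax' : a' < x by rewrite /a'; lra.
  have cx : {for x, continuous g} by apply: cg; lra.
  have [dFx <-] := continuous_FTC1_closed xb' ig ax' cx.
  by rewrite derive1E; apply: derivableP.
exists F => //.
have cF : {within `[a, b], continuous F}.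
  apply: derivable_within_continuous => x; rewrite in_itv/= => xab.
  by case: (dF _ xab).
have sub x : x \in `]a, b[ -> a <= x <= b.
  by rewrite in_itv/= => /andP[/ltW-> /ltW->].
rewrite /Rintegral (@continuous_FTC2 _ g F)//.
- by apply: cg'; lra.
- have [? ? ?] := (continuous_within_itvP F ab).1 cF.
  by split => // x /sub /dF [].
- by move=> x /sub xab; rewrite derive1E (@derive_val _ _ _ _ _ _ _ (dF _ xab)).
Qed.

(** Balls around [a] and [b] lie in [I] and the interval property fills the gap; an open interval
    inside [I] lies in its interior. *)
Lemma interior_interval_margin (R : realType) (I : set R) (a b : R) :
  is_interval I -> I° a -> I° b ->
  exists2 e : R, 0 < e & forall x, a - e < x < b + e -> I° x.
Proof.
move=> itvI /nbhs_ballP[e1/= e10 aI] /nbhs_ballP[e2/= e20 bI].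
exists (Num.min e1 e2); first by rewrite lt_min e10.
move=> x xe; have : \forall y \near x, y \in `]a - Num.min e1 e2, b + Num.min e1 e2[.
  by apply: near_in_itvoo; rewrite in_itv.
apply: filterS => y; rewrite in_itv/= => /andP[ay yb].
have m1 : Num.min e1 e2 <= e1 by rewrite ge_min lexx.
have m2 : Num.min e1 e2 <= e2 by rewrite ge_min lexx orbT.
have [ya|ay'] := ltP y a.
  by apply: aI; rewrite /ball/= ltr_norml; lra.
have [by'|yb'] := ltP b y.
  by apply: bI; rewrite /ball/= ltr_norml; lra.
apply: (itvI a b); last by rewrite ay' yb'.
- by apply: aI; exact: ballxx.
- by apply: bI; exact: ballxx.
Qed.

(** * Consequences of s-geometric convexity *)

(* The exponents t^s, for bases d <= 1 and d >= 1 respectively, are replaced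
   using s t <= t^s <= s t + (1 - s). *)
Definition excess (R : realType) (s d : R) : R := if d <= 1 then 0 else 1 - s.

Lemma powR_le_excess (R : realType) (s d t : R) :
  0 < d -> 0 < s <= 1 -> 0 <= t <= 1 ->
  d `^ (t `^ s) <= d `^ (s * t + excess s d).
Proof.
move=> d0 /andP[s0 s1] /andP[t0 t1]; rewrite /excess; case: ifPn => d1.
  rewrite addr0 ger_powR ?d0//.
  (* For a base at most 1 the exponent is bounded below, by [s * t <= t <= t ^ s]. *)
  have : s * t <= t by rewrite ler_piMl.
  have [->|tn0] := eqVneq t 0; first by rewrite mulr0 powR_ge0.
  have tgt0 : 0 < t by rewrite lt_neqAle eq_sym tn0.
  by move=> /le_trans; apply; rewrite ger1_powR// tgt0.
rewrite ler_powR//; first by rewrite ltW// ltNge.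
(* Bernoulli's inequality reads here [1 + (t ^ s - 1) / s <= t]. *)
have := @bernoulli_powR R (t `^ s) s^-1 (powR_ge0 _ _).
rewrite -powRrM divff ?gt_eqF// powRr1// invf_ge1// => /(_ s1).
rewrite -(ler_pM2l s0) mulrDr mulrA divff ?gt_eqF//.
by lra.
Qed.

(** The power [q] commutes with the other exponents and is removed by a [q]-th root; then
    [powR_le_excess] makes the exponents affine in [t]. *)
Lemma norm_le_s_geometrically_convex (R : realType) (J : set R) (g : R -> R)
    (q s x y t : R) :
  1 <= q -> 0 < s <= 1 ->
  s_geometrically_convex s J (fun x => `|g x| `^ q) ->
  J x -> J y -> 0 <= t <= 1 ->
  `|g (x `^ t * y `^ (1 - t))| <=
    `|g x| `^ (s * t + excess s `|g x|) *
    `|g y| `^ (s * (1 - t) + excess s `|g y|).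
Proof.
move=> q1 s01 [gpos gcvx] Jx Jy t01.
have q0 : 0 < q by lra.
have pos z : J z -> 0 < `|g z|.
  by move=> /gpos; exact: gt0_powR.
have t01' : 0 <= 1 - t <= 1 by lra.
apply: (@le_trans _ _ (`|g x| `^ (t `^ s) * `|g y| `^ ((1 - t) `^ s))); last first.
  by rewrite ler_pM ?powR_ge0// powR_le_excess// pos.
have powK z : 0 <= z -> z = (z `^ q) `^ q^-1.
  by move=> z0; rewrite -powRrM divff ?gt_eqF// powRr1.
rewrite [leLHS]powK// [leRHS]powK ?mulr_ge0 ?powR_ge0//.
rewrite ge0_ler_powR ?nnegrE ?powR_ge0 ?invr_ge0 ?(ltW q0)//.
rewrite powRM ?powR_ge0// (powRAC _ _ q) (powRAC `|g y| _ q).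
exact: gcvx.
Qed.

(** [excess] merges the four cases: it is 0 for a base at most 1, and completes [s] to 1
    otherwise. *)
Lemma H1E (R : realType) (a b da db s q u v : R) :
  H1 a b da db s q u v =
    a * da `^ (s + excess s da) * db `^ excess s db * u `^ q^-1 +
    b * db `^ (s + excess s db) * da `^ excess s da * v `^ q^-1.
Proof.
rewrite /H1 /excess.
have [da1|da1] := leP da 1; have [db1|db1] := leP db 1 => /=.
- by rewrite !addr0 !powRr0 !mulr1.
- rewrite (ltW db1) addr0 powRr0 mulr1 andbT [s + (1 - s)]addrC subrK.
  rewrite (powRr1 (ltW (lt_trans ltr01 db1))).
  (* When [da = 1 < db] the second test of [H1] already succeeds; the formulas agree since powers of
     1 are 1. *)
  case: leP => // da1'; have -> : da = 1 by apply/eqP; rewrite eq_le da1.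
  by rewrite !powR1 !mulr1.
- rewrite (ltW da1) addr0 powRr0 mulr1 [s + (1 - s)]addrC subrK.
  rewrite (powRr1 (ltW (lt_trans ltr01 da1))) /=.
  case: leP => // db1'; have -> : db = 1 by apply/eqP; rewrite eq_le db1.
  by rewrite !powR1 !mulr1.
- rewrite (ltW da1) (ltW db1)/= [s + (1 - s)]addrC subrK.
  rewrite (powRr1 (ltW (lt_trans ltr01 da1))).
  by rewrite (powRr1 (ltW (lt_trans ltr01 db1))).
Qed.

(** * Combined bound and its exponential form *)

(** Sum of the two one-sided estimates, followed by [g1_powR_le]. At [h = 1] the integral of [phi]
    is counted twice; at [h = 1/2] the two pieces tile [0, 1]. *)
Lemma weighted_bound (R : realType) (phi dphi Theta : R -> R)
    (L C1 C2 m q h : R) :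
  1 <= q -> 0 <= L -> 0 <= C1 -> C2 = C1 * expR m ->
  (forall x : R, 0 <= x <= 1 -> is_derive x (1 : R) Theta (phi x)) ->
  (forall x : R, 0 <= x <= 1 -> is_derive x (1 : R) phi (dphi x)) ->
  (forall x : R, 0 <= x <= 1 -> `|dphi x| <= L * C1 * expR (m * x)) ->
  0 < h <= 1 ->
  `|h * (phi h + phi (1 - h)) - (Theta h - Theta 0 + (Theta 1 - Theta (1 - h)))|
    <= L * h ^+ 2 * 2^-1 `^ (1 - q^-1) *
       (C1 * g1 (expR (q * (m * h))) `^ q^-1 +
        C2 * g1 (expR (- (q * (m * h)))) `^ q^-1).
Proof.
move=> q1 L0 C10 C2E dT dp dple h01.
have C20 : 0 <= C2 by rewrite C2E mulr_ge0 ?expR_ge0.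
have EL := left_estimate dT dp dple h01.
have ER := right_estimate dT dp dple h01.
rewrite -(mulrA L) -C2E in ER.
have -> : h * (phi h + phi (1 - h)) - (Theta h - Theta 0 + (Theta 1 - Theta (1 - h)))
  = (h * phi h - (Theta h - Theta 0)) + (h * phi (1 - h) - (Theta 1 - Theta (1 - h))).
  by ring.
apply: le_trans (ler_normD _ _) _.
apply: le_trans (lerD EL ER) _.
have h20 : 0 <= h ^+ 2 by rewrite sqr_ge0.
rewrite mulrDr lerD//.
  have -> : L * h ^+ 2 * 2^-1 `^ (1 - q^-1) * (C1 * g1 (expR (q * (m * h))) `^ q^-1) =
    L * C1 * (h ^+ 2 * (2^-1 `^ (1 - q^-1) * g1 (expR (q * (m * h))) `^ q^-1)) by ring.
  by rewrite ler_wpM2l ?mulr_ge0// ler_wpM2l// g1_powR_le.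
have -> : L * h ^+ 2 * 2^-1 `^ (1 - q^-1) * (C2 * g1 (expR (- (q * (m * h)))) `^ q^-1) =
  L * C2 * (h ^+ 2 * (2^-1 `^ (1 - q^-1) * g1 (expR (q * (- m * h))) `^ q^-1)).
  by rewrite mulNr mulrN; ring.
by rewrite ler_wpM2l ?mulr_ge0// ler_wpM2l// g1_powR_le.
Qed.

Lemma half_powR_shift (R : realType) (n : nat) (x : R) :
  2^-1 `^ (n%:R + x) = 2^-1 ^+ n * 2^-1 `^ x :> R.
Proof.
rewrite powRD ?powR_mulrn ?invr_ge0//.
by rewrite invr_eq0 pnatr_eq0 implybT.
Qed.

(** All exponents being affine in [t], the bound on [|f'|] at [b ^ t * a ^ (1 - t)], times that
    point, is a single exponential in [t]. *)
Lemma powR_geodesic (R : realType) (a b c d s k l t : R) :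
  0 < a -> 0 < b -> 0 < c -> 0 < d ->
  d `^ (s * t + l) * c `^ (s * (1 - t) + k) * (b `^ t * a `^ (1 - t)) =
  a * c `^ (s + k) * d `^ l * expR ((ln b - ln a + s * (ln d - ln c)) * t).
Proof.
move=> a0 b0 c0 d0.
have powRE (y r : R) : 0 < y -> y `^ r = expR (r * ln y).
  by move=> y0; rewrite /powR gt_eqF.
rewrite !powRE// -{2}(lnK a0).
move: (ln a) (ln b) (ln c) (ln d) => la lb lc ld.
have prod_expR (u v w x u' v' w' x' : R) :
    u + v + (w + x) = u' + v' + w' + x' ->
    expR u * expR v * (expR w * expR x) = expR u' * expR v' * expR w' * expR x'.
  by rewrite -!expRD => ->.
by apply: prod_expR; ring.
Qed.

(** Identifies [theta1] as [expR (q * m)]; exchanging the endpoints gives [theta2]. *)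
Lemma ratio_powR (R : realType) (a b c d s q : R) :
  0 < a -> 0 < b -> 0 < c -> 0 < d ->
  ((b * d `^ s) / (a * c `^ s)) `^ q =
  expR (q * (ln b - ln a + s * (ln d - ln c))).
Proof.
move=> a0 b0 c0 d0; rewrite (mulrC q) expRM; congr (_ `^ _).
rewrite -[LHS]lnK ?posrE ?divr_gt0 ?mulr_gt0 ?powR_gt0//; congr expR.
rewrite ln_div ?posrE ?mulr_gt0 ?powR_gt0// !lnM ?posrE ?powR_gt0//.
by rewrite !ln_powR; ring.
Qed.

(** * The two inequalities *)

Theorem theorem4 (R : realType) (I : set R) (f : R -> R) (a b s q : R)
    (itvI : is_interval I)
    (I_gt0 : forall x, I x -> 0 < x)
    (f_gt0 : forall x, I x -> 0 < f x)
    (df : forall x, I° x -> derivable f x 1)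
    (aI : I° a) (bI : I° b) (ab : a < b)
    (intf' : (@lebesgue_measure R).-integrable `[a, b] (EFin \o derive1 f))
    (q_ge1 : 1 <= q) (s_gt0 : 0 < s) (s_le1 : s <= 1)
    (cvxf' : s_geometrically_convex s `[a, b] (fun x => `|derive1 f x| `^ q)) :
  let da := `|derive1 f a| in
  let db := `|derive1 f b| in
  let theta1 := ((b * db `^ s) / (a * da `^ s)) `^ q in
  let theta2 := ((a * da `^ s) / (b * db `^ s)) `^ q in
  let theta3 := Num.sqrt theta1 in
  let theta4 := Num.sqrt theta2 in
  let mean := (ln b - ln a)^-1 *
    \int[@lebesgue_measure R]_(x in `[a, b]) (f x / x) in
  `|(f a + f b) / 2 - mean|
    <= ln (b / a) * 2^-1 `^ (2 - q^-1) * H1 a b da db s q (g1 theta1) (g1 theta2)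
  /\
  `|f (Num.sqrt (a * b)) - mean|
    <= ln (b / a) * 2^-1 `^ (3 - q^-1) * H1 a b da db s q (g1 theta3) (g1 theta4).
Proof.
move=> da db theta1 theta2 theta3 theta4 mean.
have q0 : 0 < q by lra.
have [e e0 Ie] := interior_interval_margin itvI aI bI.
have a0 : 0 < a by apply: I_gt0; exact: interior_subset.
have b0 : 0 < b by apply: I_gt0; exact: interior_subset.
have s01 : 0 < s <= 1 by rewrite s_gt0.
have Jpos x : `[a, b]%classic x -> 0 < `|derive1 f x|.
  by move=> /cvxf'.1; exact: gt0_powR.
have Ja : `[a, b]%classic a by rewrite /= in_itv/= lexx ltW.
have Jb : `[a, b]%classic b by rewrite /= in_itv/= lexx ltW.
have da0 : 0 < da by exact: Jpos.
have db0 : 0 < db by exact: Jpos.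
have [F dF intF] : exists2 F : R -> R,
    (forall x, a <= x <= b -> is_derive x (1 : R) F (f x / x)) &
    \int[@lebesgue_measure R]_(x in `[a, b]) (f x / x) = F b - F a.
  apply: (exists_primitive e0 ab) => x xe; have Ix := Ie _ xe.
  apply: cvgM.
    by apply/differentiable_continuous/derivable1_diffP/df.
  by apply: cvgV; rewrite ?gt_eqF// I_gt0//; exact: interior_subset.
pose L := ln b - ln a.
have L0 : 0 < L by rewrite subr_gt0 ltr_ln.
have LE : ln (b / a) = L by rewrite ln_div.
(* This is [a ^ (1 - t) * b ^ t], written so that its derivative is [L * X t]. *)
pose X t := a * expR (L * t).
have X0 t : 0 < X t by rewrite mulr_gt0 ?expR_gt0.
have Xab t : 0 <= t <= 1 -> a <= X t <= b.
  move=> /andP[t0 t1]; have bE : b = a * expR L.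
    by rewrite expRD expRN !lnK// mulrCA divff ?gt_eqF// mulr1.
  rewrite /X [X in _ <= _ <= X]bE -{1}(mulr1 a) !ler_pM2l// -expR0 !ler_expR.
  by rewrite mulr_ge0 ?(ltW L0)//= ler_piMr// ltW.
have dX (t : R) : is_derive t (1 : R) X (L * X t).
  have ? := is_derive_expR_scale L t.
  by apply: is_derive_eq; rewrite /GRing.scale/= /X mulrCA.
have dphi (t : R) : 0 <= t <= 1 ->
    is_derive t (1 : R) (f \o X) (derive1 f (X t) * (L * X t)).
  move=> t01; have Xt := Xab _ t01.
  have fX : is_derive (X t) (1 : R) f (derive1 f (X t)).
    rewrite derive1E; apply/derivableP/df/Ie.
    by case/andP: Xt => ? ?; lra.
  exact: is_derive1_comp.
(* [F \o X / L] is a primitive of [f \o X] by the chain rule, so its increment over [0, 1] is [mean]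
   without a change of variables in the integral. *)
have dTheta (t : R) : 0 <= t <= 1 ->
    is_derive t (1 : R) (fun t => L^-1 * (F \o X) t) ((f \o X) t).
  move=> t01; have FX := is_derive1_comp (dF _ (Xab _ t01)) (dX t).
  apply: is_derive_eq; rewrite /GRing.scale/=; field.
  by rewrite !gt_eqF.
pose ea := excess s da; pose eb := excess s db.
pose C1 := a * da `^ (s + ea) * db `^ eb.
pose C2 := b * db `^ (s + eb) * da `^ ea.
pose m := L + s * (ln db - ln da).
have expRln y r : 0 < y -> y `^ r = expR (r * ln y).
  by move=> y0; rewrite /powR gt_eqF.
have C1E : C1 = expR (ln a + (s + ea) * ln da + eb * ln db).
  by rewrite /C1 !expRln// -{1}(lnK a0) -!expRD.
have C2E : C2 = C1 * expR m.
  rewrite C1E /C2 !expRln// -{1}(lnK b0) -!expRD; congr expR.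
  by rewrite /m /L; ring.
have dphi_le (t : R) : 0 <= t <= 1 ->
    `|derive1 f (X t) * (L * X t)| <= L * C1 * expR (m * t).
  move=> t01.
  have XE : X t = b `^ t * a `^ (1 - t).
    rewrite /X !expRln// -{1}(lnK a0) -!expRD; congr expR.
    by rewrite /L; ring.
  rewrite normrM (gtr0_norm (mulr_gt0 L0 (X0 t))).
  have := norm_le_s_geometrically_convex q_ge1 s01 cvxf' Jb Ja t01.
  rewrite -XE -/da -/db -/ea -/eb => H.
  apply: le_trans (ler_wpM2r _ H) _; first by rewrite mulr_ge0 ?ltW.
  rewrite le_eqVlt; apply/orP; left; apply/eqP.
  rewrite mulrCA -(mulrA L); congr (_ * _).
  by rewrite XE; exact: powR_geodesic.
have C10 : 0 <= C1 by rewrite C1E expR_ge0.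
have bound := weighted_bound q_ge1 (ltW L0) C10 C2E dTheta dphi dphi_le.
have X0E : X 0 = a by rewrite /X mulr0 expR0 mulr1.
have X1E : X 1 = b.
  by rewrite /X mulr1 expRD expRN !lnK// mulrCA divff ?gt_eqF// mulr1.
have XhE : X 2^-1 = Num.sqrt (a * b).
  rewrite -powR12_sqrt ?mulr_ge0 ?ltW// expRln ?mulr_gt0// lnM//.
  by rewrite /X -{1}(lnK a0) -expRD; congr expR; rewrite /L; field.
have meanE : mean = L^-1 * F b - L^-1 * F a by rewrite /mean intF mulrBr.
have th1 : theta1 = expR (q * m) by exact: ratio_powR.
have th2 : theta2 = expR (- (q * m)).
  by rewrite /theta2 (ratio_powR s q b0 a0 db0 da0); congr expR; rewrite /m /L; ring.
(* Square roots halve the exponent, so [theta3] and [theta4] match the rate at [h = 1/2]. *)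
have sqrt_expR y : Num.sqrt (expR y) = expR (y * 2^-1).
  by rewrite -powR12_sqrt ?expR_ge0// expRM.
have HE u v : H1 a b da db s q u v = C1 * u `^ q^-1 + C2 * v `^ q^-1.
  exact: H1E.
rewrite LE /theta3 /theta4 th1 th2 !sqrt_expR !HE.
(* The power [1 - q^-1] comes from Jensen's inequality. The remaining factor is 1/2 from averaging
   two integrals when [h = 1], and [h ^+ 2] when [h = 1/2]. *)
have E2 : 2 - q^-1 = 1%:R + (1 - q^-1) by ring.
have E3 : 3 - q^-1 = 2%:R + (1 - q^-1) by ring.
rewrite E2 E3 !half_powR_shift expr1; split.
  have := bound 1; rewrite subrr /= X0E X1E -meanE !mulr1 mul1r ltr01 lexx.
  move=> /(_ isT); set M := C1 * _ + _; move: (_ `^ (1 - q^-1)) => p.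
  have -> : f b + f a - (mean + mean) = 2 * ((f a + f b) / 2 - mean) by field.
  rewrite normrM ger0_norm// expr1n mulr1.
  set N := `|_| => H.
  rewrite -(ler_pM2l (ltr0n R 2)) (le_trans H)// le_eqVlt; apply/orP; left.
  by apply/eqP; field.
(* For [h = 1/2] both evaluation points [h] and [1 - h] map to the geometric mean. *)
have h1 : 0 < (2^-1 : R) <= 1 by lra.
have := bound _ h1.
have -> : 1 - 2^-1 = 2^-1 :> R by field.
rewrite /= X0E X1E XhE !mulrA mulNr.
have -> : 2^-1 * (f (Num.sqrt (a * b)) + f (Num.sqrt (a * b))) = f (Num.sqrt (a * b)).
  by field.
set N := (X in `|_ - X|).
have -> : N = mean by rewrite /N meanE; ring.
by [].
Qed.
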